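(* Let $n\ge 1$, let $\mathcal{M}_{A_1}(\mathbb{R}^n)$ be the set of all measurable functions on $\mathbb{R}^n$ possessing an $A_1$ majorant, and let $M$ be the Hardy–Littlewood maximal operator. Then $$\mathcal{M}_{A_1}(\mathbb{R}^n)=\bigcup\{\mathcal{X} : M\in B(\mathcal{X})\},$$ where the union is over all Banach function spaces $\mathcal{X}=\mathcal{X}(\mathbb{R}^n,\rho)$ on which $M$ is bounded. Equivalently, a measurable function $f$ on $\mathbb{R}^n$ satisfies $|f|\le w$ a.e. for some $A_1$ weight $w$ if and only if there is a Banach function norm $\rho$ such that $\rho(|f|)<\infty$ and $M$ is bounded on $\mathcal{X}(\mathbb{R}^n,\rho)$.
   Context: Measurability, ''a.e.'' and $|Q|$ refer to Lebesgue measure on $\mathbb{R}^n$; functions are identified when they agree a.e. Hardy–Littlewood maximal operator: for measurable $f$ on $\mathbb{R}^n$, $$Mf(x)=\sup_{Q\ni x}\frac{1}{|Q|}\int_Q |f|\,dx,$$ the supremum being over all cubes $Q\subset\mathbb{R}^n$ (sides parallel to the axes) containing $x$. $A_1$ weight: a positive locally integrable function $w$ on $\mathbb{R}^n$ for which there is a constant $C$ with $Mw\le Cw$ a.e. $\mathcal{M}_{A_1}(\mathbb{R}^n)$: the set of measurable functions $f$ on $\mathbb{R}^n$ for which there exists an $A_1$ weight $w$ with $|f|\le w$ (a.e.). Banach function norm: a mapping $\rho$ defined on the set of non-negative measurable functions on $\mathbb{R}^n$ with values in $[0,\infty]$ such that, for all non-negative measurable $f,g,f_k$: 1. $\rho(f)=0$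 if and only if $f=0$ a.e.; $\rho(af)=a\rho(f)$ for $a>0$; $\rho(f+g)\le\rho(f)+\rho(g)$; 2. if $0\le f\le g$ a.e., then $\rho(f)\le\rho(g)$; 3. if $f_k\uparrow f$ a.e., then $\rho(f_k)\uparrow\rho(f)$; 4. if $B\subset\mathbb{R}^n$ is a bounded (measurable) set, then $\rho(\chi_B)<\infty$; 5. if $B\subset\mathbb{R}^n$ is a bounded (measurable) set, then there is a constant $C_B\in(0,\infty)$, independent of $f$, with $\int_B f\,dx\le C_B\,\rho(f)$. Banach function space: given a Banach function norm $\rho$, $\mathcal{X}=\mathcal{X}(\mathbb{R}^n,\rho)$ is the collection of all measurable functions $f$ on $\mathbb{R}^n$ with $\rho(|f|)<\infty$, normed by $\|f\|_{\mathcal{X}}=\rho(|f|)$. $M\in B(\mathcal{X})$ means that $M$ is bounded on $\mathcal{X}$: there is a constant $C<\infty$ such that $\|Mf\|_{\mathcal{X}}\le C\|f\|_{\mathcal{X}}$ for all $f\in\mathcal{X}$. *)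

(* Defs.v *)
From HB Require Import structures.
From mathcomp Require Import all_boot all_order all_algebra.
From mathcomp Require Import all_classical all_reals all_analysis.
From mathcomp Require Import measurable_realfun.

Set Implicit Arguments.
Unset Strict Implicit.
Unset Printing Implicit Defensive.
Import Order.TTheory GRing.Theory Num.Theory.
Import numFieldNormedType.Exports.

Local Open Scope classical_set_scope.
Local Open Scope ring_scope.

(* The Lebesgue measure on the Borel sets of R^n (n-tuples), as an iterated
   product; its completion, transported to 'rV[R]_n, is lebesgue_Rn below. *)
Section product_step.
Local Open Scope ereal_scope.
Context {R : realType} {n : nat}.
Local Notation Rt := (measurableTypeR R).
Variable m : {sigma_finite_measure set (n.-tuple Rt) -> \bar R}.

Definition tcons (p : Rt * n.-tuple Rt) : n.+1.-tuple Rt :=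
  [tuple of p.1 :: p.2].

Lemma measurable_tcons : measurable_fun [set: Rt * n.-tuple Rt] tcons.
Proof. exact: (measurable_cons measurable_fst measurable_snd). Qed.

Definition consm : set (n.+1.-tuple Rt) -> \bar R :=
  pushforward ((@lebesgue_measure R) \x m) tcons.

Let consm0 : consm set0 = 0.
Proof. by rewrite /consm /pushforward preimage_set0 measure0. Qed.

Let consm_ge0 A : 0 <= consm A.
Proof. exact: (measure_ge0 ((@lebesgue_measure R) \x m)). Qed.

Let consm_sigma_additive : semi_sigma_additive consm.
Proof.
have mpre A : measurable A -> measurable (tcons @^-1` A).
  by move=> mA; rewrite -[X in measurable X]setTI; exact: measurable_tcons.
move=> F mF tF mUF; rewrite /consm /pushforward preimage_bigcup.
apply: (measure_semi_sigma_additive (s := (@lebesgue_measure R) \x m)).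
- by move=> k; exact: mpre.
- apply/trivIsetP => i j _ _ ij; rewrite -preimage_setI.
  by move/trivIsetP : tF => /(_ _ _ I I ij) ->; rewrite preimage_set0.
- by rewrite -preimage_bigcup; exact: mpre.
Qed.

HB.instance Definition _ := isMeasure.Build _ _ _ consm
  consm0 consm_ge0 consm_sigma_additive.

Let consm_sigma_finite : sigma_finite setT consm.
Proof.
have /sigma_finiteP[F [TF ndF Foo]] := sigma_finiteT (@lebesgue_measure R).
have /sigma_finiteP[G [TG ndG Goo]] := sigma_finiteT m.
pose H k : set (n.+1.-tuple Rt) :=
  [set t | F k (thead t) /\ G k [tuple of behead t]].
exists H.
  apply/seteqP; split => // t _.
  have : setT (thead t) by [].
  rewrite TF => -[i _ Fi].
  have : setT [tuple of behead t] by [].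
  rewrite TG => -[j _ Gj].
  exists (maxn i j) => //; split.
  - by move: Fi; apply/subsetPset/ndF/leq_maxl.
  - by move: Gj; apply/subsetPset/ndG/leq_maxr.
move=> k; have [mF Fk] := Foo k; have [mG Gk] := Goo k.
have preE : tcons @^-1` H k = F k `*` G k.
  have beheadK (x : Rt) (t : n.-tuple Rt) :
    [tuple of behead [tuple of x :: t]] = t by exact/val_inj.
  by apply/seteqP; split => -[x t]; rewrite /H/= theadE beheadK.
split; last first.
  by rewrite /consm /pushforward preE product_measure1E// lte_mul_pinfty// ge0_fin_numE.
rewrite (_ : H k = (@thead n Rt) @^-1` F k `&`
                   (fun t : n.+1.-tuple Rt => [tuple of behead t]) @^-1` G k)//.
apply: measurableI; rewrite -[X in measurable X]setTI.
- exact: (measurable_tnth ord0).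
- exact: measurable_behead.
Qed.

HB.instance Definition _ := Measure_isSigmaFinite.Build _ _ _ consm
  consm_sigma_finite.

Definition sfconsm : {sigma_finite_measure set (n.+1.-tuple Rt) -> \bar R} :=
  consm.

End product_step.

Fixpoint tuple_lebesgue {R : realType} (n : nat) :
    {sigma_finite_measure set (n.-tuple (measurableTypeR R)) -> \bar R} :=
  match n with
  | 0 => \d_ [tuple]
  | n'.+1 => sfconsm (tuple_lebesgue n')
  end.


Section tuple_lebesgue_box.
Local Open Scope ereal_scope.
Context {R : realType}.
Local Notation Rt := (measurableTypeR R).

Lemma measurable_tuple_box n (A : 'I_n -> set Rt) :
  (forall i, measurable (A i)) ->
  measurable [set t : n.-tuple Rt | forall i, A i (tnth t i)].
Proof.
move=> mA.
rewrite (_ : mkset _ = \bigcap_(i in [set: 'I_n]) ((@tnth n Rt ^~ i) @^-1` A i)).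
  apply: fin_bigcap_measurable => // i _.
  by rewrite -[X in measurable X]setTI; exact: measurable_tnth.
by apply/seteqP; split=> t /= tA i => [_|]; exact: tA.
Qed.

Lemma tuple_lebesgue_box n (A : 'I_n -> set Rt) :
  (forall i, measurable (A i)) ->
  tuple_lebesgue n [set t | forall i, A i (tnth t i)] =
  \prod_(i < n) lebesgue_measure (A i).
Proof.
elim: n A => [|n IHn] A mA.
  rewrite big_ord0 /= diracE mem_set//; by case.
rewrite big_ord_recl -(IHn (A \o lift ord0))//=.
rewrite -product_measure1E//; last first.
  by apply: (measurable_tuple_box (A := fun i => A (lift ord0 i))) => i; exact: mA.
rewrite /consm /pushforward; congr (_ _).
apply/seteqP; split => -[x t]/=.
  by move=> H; split=> [|i]; [exact: (H ord0)|have := H (lift ord0 i); rewrite tnthS].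
by move=> [Ax At] i; case: (unliftP ord0 i) => [j ->|->]//; rewrite tnthS; exact: At.
Qed.

End tuple_lebesgue_box.

Section lebesgue_Rn.
Local Open Scope ereal_scope.
Context (R : realType) (n : nat).

Definition row_of_tuple (t : n.-tuple (measurableTypeR R)) : 'rV[R]_n :=
  \row_i tnth t i.

Definition lebesgue_outer (A : set 'rV[R]_n) : \bar R :=
  mu_ext (@tuple_lebesgue R n) (row_of_tuple @^-1` A).

Let outer0 : lebesgue_outer set0 = 0.
Proof. by rewrite /lebesgue_outer preimage_set0 mu_ext0. Qed.

Let outer_ge0 A : 0 <= lebesgue_outer A.
Proof. exact: mu_ext_ge0. Qed.

Let le_outer : {homo lebesgue_outer : A B / A `<=` B >-> A <= B}.
Proof. by move=> A B AB; apply: le_mu_ext => t; exact: AB. Qed.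

Let outer_sigma_subadditive : sigma_subadditive lebesgue_outer.
Proof.
by move=> F; rewrite /lebesgue_outer preimage_bigcup; exact: mu_ext_sigma_subadditive.
Qed.

HB.instance Definition _ := isOuterMeasure.Build R _ lebesgue_outer
  outer0 outer_ge0 le_outer outer_sigma_subadditive.

(* 'rV[R]_n with the sigma-algebra of Lebesgue (not only Borel) measurable
   sets: the Caratheodory measurable sets of the Lebesgue outer measure. *)
Definition Rn := caratheodory_type lebesgue_outer.
HB.instance Definition _ := Measurable.on Rn.

Definition lebesgue_Rn : set Rn -> \bar R := lebesgue_outer.
HB.instance Definition _ := isMeasure.Build _ _ _ lebesgue_Rn
  (@caratheodory_measure0 R _ lebesgue_outer)
  (@caratheodory_measure_ge0 R _ lebesgue_outer)
  (caratheodory_measure_sigma_additive (mu := lebesgue_outer)).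

End lebesgue_Rn.
Arguments lebesgue_Rn {R n}.

Lemma lebesgue_Rn_box (R : realType) n (A : 'I_n -> set (measurableTypeR R)) :
  (forall i, measurable (A i)) ->
  lebesgue_Rn [set x : 'rV[R]_n | forall i, A i (x ord0 i)] =
  (\prod_(i < n) lebesgue_measure (A i))%E.
Proof.
move=> mA; rewrite -tuple_lebesgue_box// /lebesgue_Rn /lebesgue_outer.
rewrite (_ : _ @^-1` _ = [set t | forall i, A i (tnth t i)]).
  by apply: measurable_mu_extE; exact: measurable_tuple_box.
by apply/seteqP; split=> t /= + i => /(_ i); rewrite mxE.
Qed.

(* Functions take values in \bar R because maximal f may be +oo. A weight is
   a.e. finite by local integrability, hence so are the functions it majorizes;
   elements of a Banach function space are a.e. finite by bfn_integral. *)
Section definitions.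
Local Open Scope ereal_scope.
Context {R : realType} {n : nat}.
Local Notation Rn := (Rn R n).
Local Notation lambda := (@lebesgue_Rn R n).
Implicit Types (f g w : Rn -> \bar R) (rho : (Rn -> \bar R) -> \bar R).

(* Open cubes; closed or half-open ones give the same maximal function at every
   point. *)
Definition cube (a : 'rV[R]_n) (l : R) : set Rn :=
  [set x : 'rV[R]_n |
    forall i, (a ord0 i < x ord0 i < a ord0 i + l)%R].

Definition is_cube (Q : set Rn) : Prop :=
  exists a l, (0 < l)%R /\ Q = cube a l.

Definition maximal f (x : Rn) : \bar R :=
  ereal_sup [set (lambda Q)^-1 * \int[lambda]_(y in Q) `|f y|
            | Q in [set Q | is_cube Q /\ Q x]].

Definition locally_integrable_Rn f : Prop :=
  measurable_fun setT f /\
  forall K : set 'rV[R]_n, compact K ->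
    \int[lambda]_(x in (K : set Rn)) `|f x| < +oo.

Definition A1_weight w : Prop :=
  [/\ {ae lambda, forall x, 0 < w x},
      locally_integrable_Rn w &
      exists C : R, {ae lambda, forall x, maximal w x <= C%:E * w x}].

Definition A1_majorized : set (Rn -> \bar R) :=
  [set f | measurable_fun setT f /\
    exists w, A1_weight w /\ {ae lambda, forall x, `|f x| <= w x}].

Definition nonneg_measurable f : Prop :=
  measurable_fun setT f /\ forall x, 0 <= f x.

Definition bounded_measurable (B : set Rn) : Prop :=
  measurable B /\ bounded_set (B : set 'rV[R]_n).

(* rho is a total function, but only its values on non-negative measurable
   functions are constrained or used. *)
Record banach_function_norm rho : Prop := BanachFunctionNorm {
  bfn_ge0 : forall f, nonneg_measurable f -> 0 <= rho f ;
  bfn_eq0 : forall f, nonneg_measurable f ->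
    rho f = 0 <-> {ae lambda, forall x, f x = 0} ;
  bfn_scale : forall (a : R) f, (0 < a)%R -> nonneg_measurable f ->
    rho (fun x => a%:E * f x) = a%:E * rho f ;
  bfn_add : forall f g, nonneg_measurable f -> nonneg_measurable g ->
    rho (fun x => f x + g x) <= rho f + rho g ;
  bfn_le : forall f g, nonneg_measurable f -> nonneg_measurable g ->
    {ae lambda, forall x, f x <= g x} -> rho f <= rho g ;
  bfn_fatou : forall (F : nat -> Rn -> \bar R) f,
    (forall k, nonneg_measurable (F k)) -> nonneg_measurable f ->
    {ae lambda, forall x,
      nondecreasing_seq (F ^~ x) /\ F ^~ x @ \oo --> f x} ->
    nondecreasing_seq (rho \o F) /\ rho \o F @ \oo --> rho f ;
  bfn_indic : forall B, bounded_measurable B ->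
    rho (fun x => (\1_B x)%:E) < +oo ;
  bfn_integral : forall B, bounded_measurable B ->
    exists C : R, (0 < C)%R /\ forall f, nonneg_measurable f ->
      \int[lambda]_(x in B) f x <= C%:E * rho f }.

Definition bfs_norm rho f : \bar R := rho (fun x => `|f x|).

Definition bfs rho : set (Rn -> \bar R) :=
  [set f | measurable_fun setT f /\ bfs_norm rho f < +oo].

Definition maximal_bounded_on rho : Prop :=
  exists C : R, forall f, bfs rho f ->
    bfs_norm rho (maximal f) <= C%:E * bfs_norm rho f.

End definitions.
Arguments A1_majorized R n : clear implicits.

(* Main.v *)
Require Import Defs.
From mathcomp Require Import all_boot all_order all_algebra.
From mathcomp Require Import all_classical all_reals all_analysis.
From mathcomp Require Import measurable_realfun ring.
Import Order.TTheory GRing.Theory Num.Theory.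
Import numFieldNormedType.Exports.
Local Open Scope classical_set_scope.
Local Open Scope ring_scope.

(** Each implication comes from an explicit construction: a norm out of a weight,
and a weight out of a norm.

If an A_1 weight w majorizes |f|, then f lies in the weighted space
{g : |g| <= c w a.e. for some c}, normed by the least such c
([weighted_sup_norm]). The maximal operator is bounded there because it is
monotone and homogeneous: |g| <= c w gives M g <= c M w <= c C w. The lattice
properties of the norm follow from the fact that the least constant is attained
([weighted_sup_norm_attained]), because w is positive and finite a.e. The two
axioms about bounded sets express local properties of w: every bounded set B lies in a
cube Q, and C w >= M w >= (the mean of w over Q) > 0 a.e. on Q, so that the
indicator of B has finite norm ([A1_weight_bounded_below]); and w is integrable
on B, which bounds the integral of g over B by c times the integral of w.

Conversely, if M is bounded with constant C on the space given by rho, the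
Rubio de Francia series w = sum_k (2 C)^-k M^k g ([rubio_de_francia]) satisfies
g <= w through its first term and M w <= 2 C w because M is countably
subadditive. Its integral over a bounded set is controlled term by term by
rho (M^k g) <= C^k rho g, hence by a geometric series. Taking for g the sum of
|f| and the indicator of a cube makes M g, and thus w, positive everywhere.

Both directions rest on elementary facts about cubes: the open cubes are the
balls of the sup norm, so open sets are Lebesgue measurable and M g is lower
semicontinuous, hence measurable. *)

(** * Cubes and the Lebesgue measure of R^n *)

Section cubes.
Context {R : realType} {n : nat}.
Local Notation lambda := (@lebesgue_Rn R n).

(** The outer measure of R^n is that of n-tuples read through [row_of_tuple], so
the Caratheodory condition for A is an instance of the one for its preimage. *)
Lemma measurable_Rn_preimage (A : set 'rV[R]_n) :
  measurable (@row_of_tuple R n @^-1` A) -> measurable (A : set (Rn R n)).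
Proof.
move=> mA; suff : (@lebesgue_outer R n).-caratheodory A by [].
move=> X.
exact: (@caratheodory_measurable_mu_ext _ _ _ (@tuple_lebesgue R n) _ mA
  (@row_of_tuple R n @^-1` X)).
Qed.

Lemma cubeE (a : 'rV[R]_n) (l : R) : cube a l =
  [set x : 'rV[R]_n | forall i, `]a ord0 i, (a ord0 i + l)[%classic (x ord0 i)].
Proof. by apply/seteqP; split=> x /= h i; move: (h i); rewrite in_itv. Qed.

Lemma measurable_cube (a : 'rV[R]_n) (l : R) :
  measurable (cube a l : set (Rn R n)).
Proof.
apply: measurable_Rn_preimage; rewrite cubeE.
rewrite (_ : _ @^-1` _ = [set t : n.-tuple (measurableTypeR R) |
    forall i, `]a ord0 i, (a ord0 i + l)[%classic (tnth t i)]).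
  by apply: (measurable_tuple_box (A := fun i =>
    `]a ord0 i, (a ord0 i + l)[%classic)) => i; exact: measurable_itv.
by apply/seteqP; split=> t /= h i; move: (h i); rewrite mxE.
Qed.

Lemma lebesgue_cube (a : 'rV[R]_n) (l : R) : 0 < l ->
  lambda (cube a l) = (l ^+ n)%:E.
Proof.
move=> l0; rewrite cubeE (lebesgue_Rn_box
  (A := fun i => `]a ord0 i, (a ord0 i + l)[%classic))//.
rewrite (eq_bigr (fun=> l%:E)); last first.
  move=> i _; rewrite lebesgue_measure_itv/= lte_fin ltrDl l0.
  by rewrite -EFinD addrAC subrr add0r.
by rewrite prodEFin prodr_const card_ord.
Qed.

Lemma ball_cube (x : 'rV[R]_n) (e : R) : 0 < e ->
  ball x e = cube (x - const_mx e) (e *+ 2).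
Proof.
move=> e0; apply/seteqP; split=> y /=.
  move=> -[_ h] i; have := h ord0 i; rewrite /ball/= !mxE ltr_distlC.
  by rewrite mulr2n addrA subrK.
move=> h; split=> // i j; have := h j; rewrite (ord1 i) !mxE /ball/= ltr_distlC.
by rewrite mulr2n addrA subrK.
Qed.

Lemma cube_ball (a : 'rV[R]_n) (l : R) : 0 < l ->
  cube a l = ball (a + const_mx (l / 2)) (l / 2).
Proof.
by move=> l0; rewrite ball_cube ?divr_gt0// addrK mulr2n -splitr.
Qed.

Lemma open_cube (a : 'rV[R]_n) (l : R) : 0 < l -> open (cube a l : set 'rV[R]_n).
Proof. by move=> l0; rewrite cube_ball//; apply: ball_open; rewrite divr_gt0. Qed.

(** An open set is the union of the cubes with rational corner and side that it
contains, and there are countably many of those. *)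
Lemma open_measurable_Rn (U : set 'rV[R]_n) :
  open U -> measurable (U : set (Rn R n)).
Proof.
move=> oU.
pose C (p : 'rV[rat]_n * rat) : set 'rV[R]_n :=
  cube (map_mx ratr p.1) (ratr p.2).
pose F p : set (Rn R n) := if pselect (C p `<=` U) then C p else set0.
suff -> : U = \bigcup_p F p.
  apply: countable_bigcupT_measurable => [|p]; first exact: countableP.
  by rewrite /F; case: pselect => h //=; exact: measurable_cube.
apply/seteqP; split=> [x Ux|x [p _]]; last first.
  by rewrite /F; case: pselect => //= h; exact: h.
(* For a side l < e, a corner within l below x in each coordinate gives a cube
   that contains x and stays inside the ball of radius e. *)
have /nbhs_ballP[e /= e0 xeU] : nbhs x U by exact: open_nbhs_nbhs.
have [l] := rat_in_itvoo e0; rewrite in_itv/= => /andP[l0 le].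
have q i : {q : rat | x ord0 i - ratr l < ratr q < x ord0 i}.
  apply: cid; have := @rat_in_itvoo R (x ord0 i - ratr l) (x ord0 i).
  by rewrite ltrBlDr ltrDl => /(_ l0)[q]; rewrite in_itv/=; exists q.
pose a : 'rV[rat]_n := \row_i sval (q i).
have aE i : (map_mx ratr a : 'rV[R]_n) ord0 i = ratr (sval (q i)) by rewrite !mxE.
have aP i : x ord0 i - ratr l < ratr (sval (q i)) < x ord0 i by case: (q i).
exists (a, l) => //; rewrite /F; case: pselect => [h|[]] /=.
  by move=> i /=; rewrite aE; have /andP[+ ->] := aP i; rewrite ltrBlDr.
move=> y /= h; apply: xeU; split=> // i j.
have := h j; rewrite (ord1 i) aE /ball/= => /andP[h1 h2].
have /andP[h3 h4] := aP j.
rewrite ltr_distlC; apply/andP; split.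
  by rewrite (lt_trans _ h1)// (lt_trans _ h3)// ltrD2l ltrN2.
by rewrite (lt_trans h2)// ltrD.
Qed.

Lemma compact_measurable_Rn (K : set 'rV[R]_n) :
  compact K -> measurable (K : set (Rn R n)).
Proof.
move=> cK; have cl : closed K by apply: compact_closed => //; exact: norm_hausdorff.
rewrite -[K]setCK; apply: (@measurableC _ (Rn R n)).
by apply: open_measurable_Rn; exact: closed_openC.
Qed.

Lemma bounded_sub_cube (B : set 'rV[R]_n) : bounded_set B ->
  exists a l, 0 < l /\ B `<=` cube a l.
Proof.
move=> /pinfty_ex_gt0[M M0 BM].
have M1 : 0 < M + 1 by rewrite addr_gt0.
exists (0 - const_mx (M + 1)), ((M + 1) *+ 2); split; first by rewrite mulrn_wgt0.
rewrite -ball_cube// => x /BM /= xM.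
by rewrite -ball_normE/= sub0r normrN (le_lt_trans xM)// ltrDl.
Qed.

Lemma compact_closed_box (a : 'rV[R]_n) (l : R) :
  compact [set x : 'rV[R]_n | forall i, `[a ord0 i, a ord0 i + l]%classic (x ord0 i)].
Proof.
apply: (rV_compact (A := fun i => `[a ord0 i, a ord0 i + l]%classic)) => i.
exact: segment_compact.
Qed.

End cubes.

(** * The maximal operator *)

Section maximal_theory.
Local Open Scope ereal_scope.
Context {R : realType} {n : nat}.
Local Notation lambda := (@lebesgue_Rn R n).
Implicit Types f g w : Rn R n -> \bar R.

Lemma is_cube_measurable (Q : set (Rn R n)) : is_cube Q -> measurable Q.
Proof. by move=> [a [l [_ ->]]]; exact: measurable_cube. Qed.

Lemma is_cube_at (x : Rn R n) : exists2 Q : set (Rn R n), is_cube Q & Q x.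
Proof.
exists (ball (x : 'rV[R]_n) 1%R); last exact: ballxx.
by rewrite ball_cube//; exists ((x : 'rV[R]_n) - const_mx 1)%R, (1 *+ 2)%R; split.
Qed.

(** The normalizing factor of a mean is a positive real, so that it can be moved
through integrals and series like any scalar. *)
Lemma is_cube_measureV (Q : set (Rn R n)) : is_cube Q ->
  exists2 c : R, (0 < c)%R & (lambda Q)^-1 = c%:E.
Proof.
move=> [a [l [l0 ->]]]; exists (l ^+ n)^-1%R; first by rewrite invr_gt0 exprn_gt0.
by rewrite lebesgue_cube// inver gt_eqF// exprn_gt0.
Qed.

Lemma average_le_maximal f (Q : set (Rn R n)) (x : Rn R n) : is_cube Q -> Q x ->
  (lambda Q)^-1 * \int[lambda]_(y in Q) `|f y| <= maximal f x.
Proof. by move=> cQ Qx; apply: ereal_sup_ubound; exists Q. Qed.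

Lemma maximal_leP f (x : Rn R n) (M : \bar R) :
  (forall Q, is_cube Q -> Q x ->
    (lambda Q)^-1 * \int[lambda]_(y in Q) `|f y| <= M) -> maximal f x <= M.
Proof. by move=> h; apply: ge_ereal_sup => _ [Q [cQ Qx] <-]; exact: h. Qed.

Lemma maximal_ge0 f (x : Rn R n) : 0 <= maximal f x.
Proof.
have [Q cQ Qx] := is_cube_at x.
apply: le_trans (average_le_maximal f _ _ cQ Qx).
have [c c0 ->] := is_cube_measureV Q cQ.
by rewrite mule_ge0 ?lee_fin ?(ltW c0)//; exact: integral_ge0.
Qed.

(** The cubes being open, a cube witnessing t < M f x witnesses it for all points
near x: the superlevel sets of M f are open. *)
Lemma measurable_maximal f : measurable_fun setT (maximal f).
Proof.
apply: (measurability _ (ErealGenOInfty.measurableE R)).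
move=> /= _ [_ [a ->]] <-; apply: measurableI => //.
rewrite preimage_itvoy.
apply: (open_measurable_Rn [set x : 'rV[R]_n | a%:E < maximal f x]).
rewrite openE => x /= /ereal_sup_gt[_ [Q [cQ Qx] <-]] ltQ.
case: (cQ) => b [l [l0 QE]].
have oQ : open (Q : set 'rV[R]_n) by rewrite QE; exact: open_cube.
have : nbhs (x : 'rV[R]_n) Q by exact: open_nbhs_nbhs.
apply: filterS => y Qy /=; apply: lt_le_trans ltQ _.
exact: average_le_maximal.
Qed.

Lemma le_maximal f g : measurable_fun setT f -> measurable_fun setT g ->
  {ae lambda, forall x, `|f x| <= `|g x|} ->
  forall x, maximal f x <= maximal g x.
Proof.
move=> mf mg fg x; apply: maximal_leP => Q cQ Qx.
apply: le_trans (average_le_maximal g _ _ cQ Qx).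
have mQ := is_cube_measurable _ cQ.
have [c c0 ->] := is_cube_measureV Q cQ.
apply: lee_wpmul2l; first by rewrite lee_fin ltW.
apply: (ae_ge0_le_integral mQ).
- by move=> y _; exact: abse_ge0.
- by apply: measurableT_comp => //; exact: measurable_funTS.
- by move=> y _; exact: abse_ge0.
- by apply: measurableT_comp => //; exact: measurable_funTS.
- by apply: filterS fg => y fgy _.
Qed.

Lemma maximalZ f (c : R) : (0 <= c)%R -> measurable_fun setT f ->
  forall x, maximal (fun y => c%:E * f y) x <= c%:E * maximal f x.
Proof.
move=> c0 mf x; apply: maximal_leP => Q cQ Qx.
have mQ := is_cube_measurable _ cQ.
under eq_integral do rewrite abseM gee0_abs ?lee_fin//.
rewrite (ge0_integralZl_EFin _ mQ) => [|y _||//]; last 2 first.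
- exact: abse_ge0.
- by apply: measurableT_comp => //; exact: measurable_funTS.
rewrite muleCA; apply: lee_wpmul2l; first by rewrite lee_fin.
exact: average_le_maximal.
Qed.

(** Countable subadditivity: on each cube the integral of the series is the
series of the integrals, by monotone convergence. *)
Lemma maximal_nneseries (F : nat -> Rn R n -> \bar R) :
  (forall k, nonneg_measurable (F k)) ->
  forall x, maximal (fun y => \sum_(0 <= k <oo) F k y) x <=
            \sum_(0 <= k <oo) maximal (F k) x.
Proof.
move=> F0 x; apply: maximal_leP => Q cQ Qx.
have mQ := is_cube_measurable _ cQ.
have [c c0 cE] := is_cube_measureV Q cQ.
have absE y : Q y -> `|\sum_(0 <= k <oo) F k y| = \sum_(0 <= k <oo) F k y.
  by move=> _; rewrite gee0_abs// nneseries_ge0// => k _ _; exact: (F0 k).2.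
rewrite (eq_integral (fun y => \sum_(0 <= k <oo) F k y)); last first.
  by move=> y /[!inE]; exact: absE.
rewrite (integral_nneseries _ mQ); last 2 first.
- by move=> k; apply: measurable_funTS; exact: (F0 _).1.
- by move=> k y _; exact: (F0 _).2.
have I0 k : 0 <= \int[lambda]_(y in Q) F k y.
  by apply: integral_ge0 => y _; exact: (F0 _).2.
rewrite cE -nneseriesZl//; apply: lee_nneseries => [k _ _|k _].
  by rewrite mule_ge0// lee_fin ltW.
apply: le_trans (average_le_maximal _ _ _ cQ Qx); rewrite cE.
apply: lee_wpmul2l; first by rewrite lee_fin ltW.
by under [leRHS]eq_integral do rewrite gee0_abs ?(F0 _).2//.
Qed.

(** Any point lies in a cube containing the given one; over it the mean of the
indicator is positive. *)
Lemma maximal_indic_cube_gt0 (a : 'rV[R]_n) (l : R) (x : Rn R n) : (0 < l)%R ->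
  0 < maximal (fun y => (\1_(cube a l : set (Rn R n)) y)%:E) x.
Proof.
move=> l0.
(* The ball of radius L about the corner a reaches x and covers the cube. *)
pose L := (`|a - x| + l)%R.
have L0 : (0 < L)%R by rewrite ltr_wpDl.
have ax : ball a L x by rewrite -ball_normE/= ltrDl.
have acl : cube a l `<=` ball a L.
  move=> y ay; split=> // i j; have /andP[ay1 ay2] := ay j.
  rewrite (ord1 i) /ball/= ltr_distlC (lt_le_trans ay2) ?lerD2l ?lerDr// andbT.
  by rewrite (lt_trans _ ay1)// gtrBl.
have hc : is_cube (ball a L : set (Rn R n)).
  by rewrite ball_cube//; exists (a - const_mx L)%R, (L *+ 2)%R; rewrite mulrn_wgt0.
apply: lt_le_trans (average_le_maximal _ _ x hc ax).
have [c c0 ->] := is_cube_measureV _ hc.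
rewrite mule_gt0 ?lte_fin//.
under eq_integral do rewrite gee0_abs ?lee_fin//.
rewrite integral_indic; last 2 first.
- exact: is_cube_measurable.
- exact: measurable_cube.
rewrite setIidl; last exact: acl.
by rewrite [ltRHS](lebesgue_cube a l l0) lte_fin exprn_gt0.
Qed.

End maximal_theory.

(** * Local properties of A_1 weights *)

Section weights.
Local Open Scope ereal_scope.
Context {R : realType} {n : nat}.
Local Notation lambda := (@lebesgue_Rn R n).
Implicit Types f g w : Rn R n -> \bar R.

Lemma integral_bounded_lty w (B : set (Rn R n)) :
  locally_integrable_Rn w -> bounded_measurable B ->
  \int[lambda]_(x in B) `|w x| < +oo.
Proof.
move=> [mw iw] [mB /bounded_sub_cube[a [l [l0 Bal]]]].
have cK := compact_closed_box a l.
have mK := compact_measurable_Rn _ cK.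
apply: le_lt_trans (iw _ cK).
apply: (ge0_subset_integral _ mB mK).
- by apply: measurableT_comp => //; exact: measurable_funTS.
- by move=> x _; exact: abse_ge0.
- by move=> x /Bal h i /=; rewrite in_itv/=; have /andP[/ltW-> /ltW->] := h i.
Qed.

Lemma is_cube_bounded (Q : set (Rn R n)) : is_cube Q -> bounded_measurable Q.
Proof.
move=> cQ; split; first exact: is_cube_measurable.
move: cQ => [a [l [_ ->]]].
have [M [Mr h]] := compact_bounded (compact_closed_box a l).
exists M; split=> // y /h yM x ax; apply: yM => i /=; rewrite in_itv/=.
by have /andP[/ltW-> /ltW->] := ax i.
Qed.

(** Integrability on the balls of integral radius gives finiteness a.e. on each of
them, and these countably many balls cover R^n. *)
Lemma locally_integrable_ae_lty w : locally_integrable_Rn w ->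
  {ae lambda, forall x, w x < +oo}.
Proof.
move=> lw; pose B k : set (Rn R n) := ball (0%R : 'rV[R]_n) k.+1%:R%R.
have cB k : is_cube (B k).
  rewrite /B ball_cube//; eexists _, _; split; last reflexivity.
  by rewrite mulrn_wgt0.
have : {ae lambda, forall x, forall k, B k x -> w x \is a fin_num}.
  apply: ae_foralln => k; apply: integrable_ae.
    exact: is_cube_measurable.
  apply/integrableP; split; first exact: measurable_funTS lw.1.
  by apply: integral_bounded_lty => //; exact: is_cube_bounded.
apply: filterS => x h.
suff /fin_numPlt/andP[_ ->] : w x \is a fin_num by [].
apply: (h (Num.truncn `|(x : 'rV[R]_n)|%R)).
by rewrite /B -ball_normE/= sub0r normrN truncnS_gt.
Qed.

(** Positivity of w a.e. lets the A_1 constant be enlarged to a positive one. *)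
Lemma A1_weight_const w : A1_weight w -> exists C : R, (0 < C)%R /\
  {ae lambda, forall x, maximal w x <= C%:E * w x}.
Proof.
move=> [w0 _ [C hC]]; exists (Num.max C 1)%R; split; first by rewrite lt_max ltr01 orbT.
apply: filterS2 w0 hC => x /ltW wx /le_trans -> //.
by rewrite lee_wpmul2r// lee_fin le_max lexx.
Qed.

(** On a cube Q containing B, C w >= M w is at least the mean of w over Q, which is
positive since w is positive a.e. *)
Lemma A1_weight_bounded_below w (B : set (Rn R n)) :
  A1_weight w -> bounded_measurable B ->
  exists c : R, (0 < c)%R /\ {ae lambda, forall x, B x -> c%:E <= w x}.
Proof.
move=> A1w [mB bB]; have [C [C0 MC]] := A1_weight_const _ A1w.
have [w0 lw _] := A1w.
have [a [l [l0 Bal]]] := bounded_sub_cube _ bB.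
have cQ : is_cube (cube a l : set (Rn R n)) by exists a, l.
have mQ := is_cube_measurable _ cQ.
have [v v0 vE] := is_cube_measureV _ cQ.
set I := \int[lambda]_(x in cube a l) `|w x|.
have Ioo : I < +oo by apply: integral_bounded_lty => //; exact: is_cube_bounded.
have I0 : 0 < I.
  rewrite lt_neqAle integral_ge0// andbT eq_sym; apply/eqP.
  move=> /(ae_eq_integral_abs _ mQ (measurable_funTS lw.1)) h.
  have [N [mN N0 QN]] : {ae lambda, forall x, ~ (cube a l : set (Rn R n)) x}.
    apply: filterS2 w0 h => x wx h /h wx0.
    by move: wx; rewrite wx0 ltxx.
  have : lambda (cube a l) <= lambda N.
    by apply: le_measure; rewrite ?inE// => x Qx; apply: QN => /(_ Qx).
  by rewrite N0 [leLHS](lebesgue_cube a l l0) lee_fin leNgt exprn_gt0.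
have If : I \is a fin_num by rewrite ge0_fin_numE// ltW.
have fI0 : (0 < fine I)%R by rewrite fine_gt0// I0.
exists (C^-1 * (v * fine I))%R; split; first by rewrite !mulr_gt0 ?invr_gt0.
apply: filterS MC => x Mx Bx.
have : C%:E * (C^-1 * (v * fine I))%:E <= C%:E * w x.
  apply: le_trans Mx; apply: le_trans (average_le_maximal _ _ _ cQ (Bal _ Bx)).
  by rewrite vE -/I -(fineK If) -!EFinM mulVKf ?gt_eqF.
by rewrite lee_pmul2l.
Qed.

End weights.

(** * The weighted sup-norm *)

Section weighted_norm.
Local Open Scope ereal_scope.
Context {R : realType} {n : nat}.
Local Notation lambda := (@lebesgue_Rn R n).
Implicit Types f g w : Rn R n -> \bar R.

(** This is the essential supremum of f / w for f nonnegative; the form by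
inequalities avoids dividing by w where it is 0 or infinite. *)
Definition weighted_sup_norm w f : \bar R :=
  ereal_inf [set c%:E | c in
    [set c : R | (0 <= c)%R /\ {ae lambda, forall x, f x <= c%:E * w x}]].

Lemma weighted_sup_norm_le w f (c : R) : (0 <= c)%R ->
  {ae lambda, forall x, f x <= c%:E * w x} -> weighted_sup_norm w f <= c%:E.
Proof. by move=> c0 h; apply: ereal_inf_lbound; exists c. Qed.

Lemma weighted_sup_norm_ge0 w f : 0 <= weighted_sup_norm w f.
Proof. by apply: le_ereal_inf_tmp => _ [c [c0 _] <-]; rewrite lee_fin. Qed.

(** The inequality f <= (c + 1/k) w holds a.e. for each k, hence a.e. for all k at
once, and k tends to infinity at the points where w is positive and finite. *)
Lemma weighted_sup_norm_attained w f :
  {ae lambda, forall x, 0 < w x} -> {ae lambda, forall x, w x < +oo} ->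
  weighted_sup_norm w f < +oo ->
  exists c : R, [/\ (0 <= c)%R, weighted_sup_norm w f = c%:E &
    {ae lambda, forall x, f x <= c%:E * w x}].
Proof.
move=> w0 woo foo.
have ffin : weighted_sup_norm w f \is a fin_num.
  by rewrite ge0_fin_numE// weighted_sup_norm_ge0.
exists (fine (weighted_sup_norm w f)).
split; [by rewrite fine_ge0// weighted_sup_norm_ge0 | by rewrite fineK|].
set c := fine _.
have h : {ae lambda, forall x, forall k, f x <= (c + k.+1%:R^-1)%:E * w x}.
  apply: ae_foralln => k.
  have : weighted_sup_norm w f < (c + k.+1%:R^-1)%:E.
    by rewrite -(fineK ffin) lte_fin ltrDl invr_gt0.
  move=> /ereal_inf_lt[_ [d [d0 fd] <-]] /ltW dk.
  apply: filterS2 w0 fd => x /ltW wx /le_trans; apply.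
  by rewrite lee_wpmul2r.
have w0oo : {ae lambda, forall x, 0 < w x < +oo}.
  by apply: filterS2 w0 woo => x -> ->.
apply: filterS2 w0oo h => x /andP[wx0 wxoo] fx.
have wf : w x \is a fin_num by rewrite ge0_fin_numE// ltW.
move: wx0 fx; rewrite -(fineK wf) lte_fin; set r := fine _ => r0.
move: (f x) => [s| |] fx; last 2 first.
- by have := fx 0%N.
- by rewrite leNye.
rewrite -EFinM lee_fin leNgt; apply/negP.
rewrite -ltr_pdivlMr// => /ltr_add_invr[k].
rewrite ltr_pdivlMr//; have := fx k; rewrite -EFinM lee_fin.
by rewrite leNgt => /negP.
Qed.

Lemma weighted_sup_norm_lt_pinfty w f :
  {ae lambda, forall x, f x <= w x} -> weighted_sup_norm w f < +oo.
Proof.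
move=> fw; apply: (@le_lt_trans _ _ 1%:E); last exact: ltry.
by apply: weighted_sup_norm_le => //; apply: filterS fw => x; rewrite mul1e.
Qed.

Lemma weighted_sup_norm_mono w f g :
  {ae lambda, forall x, f x <= g x} ->
  weighted_sup_norm w f <= weighted_sup_norm w g.
Proof.
move=> fg; apply: le_ereal_inf_tmp => _ [c [c0 gc] <-].
apply: weighted_sup_norm_le => //.
by apply: filterS2 fg gc => x; exact: le_trans.
Qed.

(** One inequality applied to a and to its inverse yields the equality. *)
Lemma weighted_sup_normZ w f (a : R) : (0 < a)%R ->
  weighted_sup_norm w (fun x => a%:E * f x) = a%:E * weighted_sup_norm w f.
Proof.
have le (b : R) g : (0 < b)%R ->
    weighted_sup_norm w (fun x => b%:E * g x) <= b%:E * weighted_sup_norm w g.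
  move=> b0; rewrite muleC -lee_pdivrMr//.
  apply: le_ereal_inf_tmp => _ [c [c0 gc] <-]; rewrite lee_pdivrMr// -EFinM.
  apply: weighted_sup_norm_le; first by rewrite mulr_ge0// ltW.
  by apply: filterS gc => x gx; rewrite mulrC EFinM -muleA lee_pmul2l.
move=> a0; apply/eqP; rewrite eq_le le//=.
have a1 : (0 < a^-1)%R by rewrite invr_gt0.
have := le a^-1%R (fun x => a%:E * f x) a1.
rewrite (_ : (fun x => _) = f); last first.
  by apply/funext => x; rewrite muleA -EFinM mulVf ?gt_eqF// mul1e.
rewrite -(@lee_pmul2l _ a%:E)// muleA -EFinM mulfV ?gt_eqF//.
by rewrite mul1e.
Qed.

Theorem weighted_banach_function_norm w :
  A1_weight w -> banach_function_norm (weighted_sup_norm w).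
Proof.
move=> A1w; have [w0 lw _] := A1w; have woo := locally_integrable_ae_lty _ lw.
split.
- by move=> f _; exact: weighted_sup_norm_ge0.
- move=> f [mf f0]; split=> [f_eq0|].
    have /(weighted_sup_norm_attained _ _ w0 woo)[c [_ + fc]] :
      weighted_sup_norm w f < +oo by rewrite f_eq0.
    rewrite f_eq0 => -[c0]; apply: filterS fc => x.
    by rewrite -c0 mul0e => fx; apply/eqP; rewrite eq_le fx f0.
  move=> f_eq0; apply/eqP; rewrite eq_le weighted_sup_norm_ge0 andbT.
  by apply: weighted_sup_norm_le => //; apply: filterS f_eq0 => x ->; rewrite mul0e.
- by move=> a f a0 _; exact: weighted_sup_normZ.
- move=> f g _ _.
  have [|foo] := leP +oo (weighted_sup_norm w f).
    rewrite leye_eq => /eqP ->; rewrite addye ?leey// gt_eqF//.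
    by rewrite (lt_le_trans _ (weighted_sup_norm_ge0 w g)).
  have [|goo] := leP +oo (weighted_sup_norm w g).
    rewrite leye_eq => /eqP ->; rewrite addey ?leey// gt_eqF//.
    by rewrite (lt_le_trans _ (weighted_sup_norm_ge0 w f)).
  have [c [c0 -> fc]] := weighted_sup_norm_attained _ _ w0 woo foo.
  have [d [d0 -> gd]] := weighted_sup_norm_attained _ _ w0 woo goo.
  apply: weighted_sup_norm_le; first exact: addr_ge0.
  by apply: filterS2 fc gd => x fx gx; rewrite EFinD ge0_muleDl// leeD.
- by move=> f g _ _; exact: weighted_sup_norm_mono.
- move=> F f mF mf Ff.
  have ndF : nondecreasing_seq (weighted_sup_norm w \o F).
    move=> i j ij; apply: weighted_sup_norm_mono.
    by apply: filterS Ff => x [nd _]; exact: nd.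
  (* The norms increase to their supremum S. If S is finite, then all F k are
     a.e. at most S w simultaneously, and so is their limit f. *)
  split => //; suff <- : ereal_sup (range (weighted_sup_norm w \o F)) =
    weighted_sup_norm w f by exact: ereal_nondecreasing_cvgn.
  apply/eqP; rewrite eq_le; apply/andP; split.
    apply: ge_ereal_sup => _ [k _ <-]; apply: weighted_sup_norm_mono.
    apply: filterS Ff => x [nd Ffx].
    have := ereal_nondecreasing_cvgn nd.
    move=> /(cvg_unique (@ereal_hausdorff R) Ffx) ->.
    by apply: ereal_sup_ubound; exists k.
  set S := ereal_sup _.
  have [|Soo] := leP +oo S; first by rewrite leye_eq => /eqP ->; rewrite leey.
  have Fk k : weighted_sup_norm w (F k) <= S by apply: ereal_sup_ubound; exists k.
  have S0 : 0 <= S by apply: le_trans (Fk 0%N); exact: weighted_sup_norm_ge0.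
  have Sf : S \is a fin_num by rewrite ge0_fin_numE.
  have : {ae lambda, forall x, forall k, F k x <= (fine S)%:E * w x}.
    apply: ae_foralln => k.
    have [c [c0 cE Fc]] := weighted_sup_norm_attained _ _ w0 woo
      (le_lt_trans (Fk k) Soo).
    apply: filterS2 w0 Fc => x /ltW wx /le_trans; apply.
    by rewrite lee_wpmul2r// fineK// -cE.
  rewrite -(fineK Sf) => FS; apply: weighted_sup_norm_le.
    by rewrite fine_ge0.
  apply: filterS2 Ff FS => x [nd Ffx] Fx.
  have := ereal_nondecreasing_cvgn nd.
  move=> /(cvg_unique (@ereal_hausdorff R) Ffx) ->.
  by apply: ge_ereal_sup => _ [k _ <-]; exact: Fx.
- move=> B /(A1_weight_bounded_below _ _ A1w)[c [c0 hc]].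
  apply: (@le_lt_trans _ _ (c^-1)%:E); last exact: ltry.
  apply: weighted_sup_norm_le; first by rewrite invr_ge0 ltW.
  apply: filterS2 w0 hc => x /ltW wx Bw.
  rewrite indicE; have [/set_mem Bx|_] := boolP (x \in B); last first.
    by rewrite mule_ge0// lee_fin invr_ge0 ltW.
  apply: (@le_trans _ _ (c^-1%:E * c%:E)).
    by rewrite -EFinM mulVf ?gt_eqF.
  by rewrite lee_wpmul2l ?lee_fin ?invr_ge0 ?(ltW c0)//; exact: Bw.
- move=> B bB; have := integral_bounded_lty _ _ lw bB.
  set I := \int[lambda]_(x in B) _ => Ioo.
  have I0 : 0 <= I by apply: integral_ge0.
  have If : I \is a fin_num by rewrite ge0_fin_numE.
  exists (fine I + 1)%R; split; first by rewrite ltr_wpDl// fine_ge0.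
  move=> f [mf f0].
  have [|foo] := leP +oo (weighted_sup_norm w f).
    rewrite leye_eq => /eqP ->; rewrite gt0_muley ?leey// lte_fin.
    by rewrite ltr_wpDl// fine_ge0.
  have [c [c0 -> fc]] := weighted_sup_norm_attained _ _ w0 woo foo.
  have [mB _] := bB.
  apply: (@le_trans _ _ (\int[lambda]_(x in B) (c%:E * `|w x|))).
    apply: (ae_ge0_le_integral mB).
    + by move=> x _; exact: f0.
    + exact: measurable_funTS.
    + by move=> x _; rewrite mule_ge0 ?lee_fin.
    + apply: measurable_funeM; apply: measurableT_comp => //.
      exact: measurable_funTS lw.1.
    + apply: filterS fc => x fx _; apply: le_trans fx _.
      by rewrite lee_wpmul2l ?lee_fin// lee_abs.
  rewrite (ge0_integralZl_EFin _ mB) => [|x _||//]; last 2 first.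
  + exact: abse_ge0.
  + by apply: measurableT_comp => //; exact: measurable_funTS lw.1.
  rewrite -/I -(fineK If) -!EFinM lee_fin mulrC ler_wpM2r//.
  by rewrite lerDl.
Qed.

(** From |f| <= c w follows M f <= c M w <= c C w. *)
Theorem maximal_bounded_on_weighted w :
  A1_weight w -> maximal_bounded_on (weighted_sup_norm w).
Proof.
move=> A1w; have [w0 lw _] := A1w; have woo := locally_integrable_ae_lty _ lw.
have [C [C0 MC]] := A1_weight_const _ A1w.
exists C => f [mf]; rewrite /bfs_norm => foo.
have [c [c0 -> fc]] := weighted_sup_norm_attained _ _ w0 woo foo.
rewrite -EFinM; apply: weighted_sup_norm_le; first by rewrite mulr_ge0// ltW.
apply: filterS MC => x Mx; rewrite gee0_abs ?maximal_ge0//.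
apply: (@le_trans _ _ (maximal (fun x => c%:E * w x) x)).
  apply: (le_maximal _ _ mf (measurable_funeM _ lw.1)).
  by apply: filterS fc => y /le_trans; apply; exact: lee_abs.
apply: le_trans (maximalZ _ _ c0 lw.1 x) _.
by rewrite mulrC EFinM -muleA lee_wpmul2l.
Qed.

End weighted_norm.

(** * The Rubio de Francia majorant *)

Section rubio_de_francia.
Local Open Scope ereal_scope.
Context {R : realType} {n : nat}.
Local Notation lambda := (@lebesgue_Rn R n).
Implicit Types (f g w : Rn R n -> \bar R) (rho : (Rn R n -> \bar R) -> \bar R).

Lemma nonneg_measurable_iter_maximal g k :
  nonneg_measurable g -> nonneg_measurable (iter k maximal g).
Proof.
move=> mg; case: k => [//|k]; split => [|x].
  exact: measurable_maximal.
exact: maximal_ge0.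
Qed.

(** The constant is enlarged to a positive one, since the series below divides by
its powers. *)
Lemma maximal_bounded_onP rho : banach_function_norm rho ->
  maximal_bounded_on rho -> exists C : R, (0 < C)%R /\
  forall g, nonneg_measurable g -> rho g < +oo -> rho (maximal g) <= C%:E * rho g.
Proof.
move=> nrho [C MC]; exists (Num.max C 1)%R; split; first by rewrite lt_max ltr01 orbT.
move=> g [mg g0] goo.
have absE h : (forall x, 0 <= h x) -> (fun x => `|h x|) = h.
  by move=> h0; apply/funext => x; rewrite gee0_abs.
have gX : bfs rho g by split=> //; rewrite /bfs_norm absE.
have := MC g gX; rewrite /bfs_norm !absE//; last exact: maximal_ge0.
move=> /le_trans; apply.
by rewrite lee_wpmul2r ?(bfn_ge0 nrho)// lee_fin le_max lexx.
Qed.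

(** The weight is the series of M^k g / (2 C)^k with C a bound for M. The ratio 2 C
makes the norms of the terms decay like 2^-k, and applying M only shifts the
series, at the cost of a factor 2 C. Positivity of M g makes the term k = 1, and
therefore the weight, positive. *)
Theorem rubio_de_francia rho g : banach_function_norm rho ->
  maximal_bounded_on rho -> nonneg_measurable g -> rho g < +oo ->
  (forall x, 0 < maximal g x) ->
  exists w, A1_weight w /\ forall x, g x <= w x.
Proof.
move=> nrho /(maximal_bounded_onP _ nrho)[C [C0 MC]] mg goo Mg0.
pose F k := iter k maximal g.
have mF k : nonneg_measurable (F k) by exact: nonneg_measurable_iter_maximal.
have rhoF k : rho (F k) <= (C ^+ k)%:E * rho g.
  elim: k => [|k IH]; first by rewrite expr0 mul1e.
  have Foo : rho (F k) < +oo.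
    apply: le_lt_trans IH _; apply: lte_mul_pinfty => //.
    by rewrite lee_fin exprn_ge0// ltW.
  apply: le_trans (MC _ (mF k) Foo) _.
  by rewrite exprS EFinM -muleA lee_pmul2l.
pose D := (2 * C)%R.
have D0 : (0 < D)%R by rewrite mulr_gt0.
have Dk0 k : (0 < D ^- k)%R by rewrite invr_gt0 exprn_gt0.
pose G k x := (D ^- k)%:E * F k x.
have mG k : nonneg_measurable (G k).
  split=> [|x]; first exact: measurable_funeM (mF k).1.
  by rewrite mule_ge0 ?(mF k).2// lee_fin ltW.
pose w x := \sum_(0 <= k <oo) G k x.
have G_le_w k x : G k x <= w x.
  have := @nneseries_lim_ge _ (G ^~ x) xpredT 0%N k.+1.
  move=> /(_ (fun i _ _ => (mG i).2 x)); apply: le_trans.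
  by rewrite big_nat_recr//= leeDr// sume_ge0// => i _; exact: (mG i).2.
have w0 x : 0 < w x.
  apply: lt_le_trans (G_le_w 1%N x).
  by rewrite mule_gt0 ?lte_fin//; exact: Mg0.
have mw : measurable_fun setT w.
  apply: (ge0_emeasurable_sum (h := G) (P := xpredT)) => [k x _ _|k _].
    exact: (mG k).2.
  exact: (mG k).1.
exists w; split; last first.
  by move=> x; have := G_le_w 0%N x; rewrite /G expr0 invr1 mul1e.
split; first exact: aeW.
- split=> // K cK.
  have mK := compact_measurable_Rn _ cK.
  have [c [c0 intK]] := bfn_integral nrho (conj mK (compact_bounded cK)).
  rewrite (eq_integral w) => [|x _]; last by rewrite gee0_abs// ltW.
  rewrite (integral_nneseries _ mK); last 2 first.
  - by move=> k; apply: measurable_funTS; exact: (mG k).1.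
  - by move=> k x _; exact: (mG k).2.
  have rg0 : 0 <= rho g by exact: bfn_ge0.
  have rgf : rho g \is a fin_num by rewrite ge0_fin_numE.
  (* The k-th integral is at most c rho(g) / 2^k = e / 2^(k+1), and these bounds
     sum to e. *)
  pose e := (2 * (c * fine (rho g)))%R.
  have e0 : (0 <= e)%R by rewrite !mulr_ge0// ?(ltW c0)// fine_ge0.
  apply: le_lt_trans (ltry e).
  apply: le_trans (epsilon_trick0 xpredT e0).
  apply: lee_nneseries => [k _ _|k _].
    by apply: integral_ge0 => x _; exact: (mG k).2.
  rewrite (ge0_integralZl_EFin _ mK); last 3 first.
  + by move=> x _; exact: (mF k).2.
  + by apply: measurable_funTS; exact: (mF k).1.
  + exact: ltW.
  apply: (@le_trans _ _ ((D ^- k)%:E * (c%:E * ((C ^+ k)%:E * rho g)))).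
    apply: lee_wpmul2l; first by rewrite lee_fin ltW.
    apply: le_trans (intK _ (mF k)) _.
    by rewrite lee_pmul2l.
  rewrite -{1}(fineK rgf) -!EFinM lee_fin le_eqVlt; apply/orP; left; apply/eqP.
  rewrite /e /D natrX exprS exprMn.
  by field; rewrite ?expf_neq0 ?gt_eqF.
- exists D; apply: aeW => x.
  apply: le_trans (maximal_nneseries _ mG x) _.
  have DG k : maximal (G k) x <= D%:E * G k.+1 x.
    apply: le_trans (maximalZ _ _ (ltW (Dk0 k)) (mF k).1 x) _.
    rewrite /G muleA -EFinM exprS invfM mulrA mulfV ?gt_eqF// mul1r.
    exact: lexx.
  apply: (@le_trans _ _ (\sum_(0 <= k <oo) D%:E * G k.+1 x)).
    by apply: lee_nneseries => // k _ _; exact: maximal_ge0.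
  rewrite nneseriesZl => [|k _]; last exact: (mG _).2.
  rewrite lee_pmul2l//.
  rewrite /w [leRHS]nneseries_recl//; last by move=> k _; exact: (mG k).2.
  rewrite -[leLHS]add0e leeD//; first exact: (mG 0%N).2.
  rewrite -(nneseries_addn 1%N) => [|k]; last exact: (mG k).2.
  by under [leRHS]eq_eseriesr do rewrite addn1.
Qed.

(** The indicator of a cube is added to |f| because M f vanishes when f is 0 a.e.,
in which case the series built from |f| alone is no weight. *)
Theorem A1_majorant_of_bfs rho f : banach_function_norm rho ->
  maximal_bounded_on rho -> measurable_fun setT f -> rho (fun x => `|f x|) < +oo ->
  exists w, A1_weight w /\ {ae lambda, forall x, `|f x| <= w x}.
Proof.
move=> nrho Mrho mf foo.
pose Q : set (Rn R n) := cube 0%R 1%R.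
have cQ : is_cube Q by exists 0%R, 1%R.
pose chi x : \bar R := (\1_Q x)%:E.
have nf : nonneg_measurable (fun x => `|f x|).
  by split=> [|x]; [exact: measurableT_comp|exact: abse_ge0].
have nchi : nonneg_measurable chi.
  split=> [|x]; last by rewrite lee_fin.
  apply/measurable_EFinP; apply: measurable_indic; exact: is_cube_measurable.
pose g x := `|f x| + chi x.
have g0 x : 0 <= g x by rewrite adde_ge0// nchi.2.
have ng : nonneg_measurable g.
  by split=> [|x]; [exact: emeasurable_funD nf.1 nchi.1|exact: g0].
have goo : rho g < +oo.
  apply: le_lt_trans (bfn_add nrho nf nchi) _; apply: lte_add_pinfty => //.
  exact/(bfn_indic nrho)/is_cube_bounded.
have Mg0 x : 0 < maximal g x.
  apply: lt_le_trans (maximal_indic_cube_gt0 0%R 1%R x ltr01) _.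
  apply: (le_maximal _ _ nchi.1 ng.1); apply: aeW => y.
  by rewrite gee0_abs ?nchi.2// gee0_abs// leeDr.
have [w [A1w gw]] := rubio_de_francia _ _ nrho Mrho ng goo Mg0.
exists w; split=> //; apply: aeW => x; apply: le_trans (gw x).
by rewrite leeDl// nchi.2.
Qed.

End rubio_de_francia.

(** * Functions with an A_1 majorant *)

Theorem theorem2p1 (R : realType) (n : nat) (n_ge1 : (1 <= n)%N) :
  A1_majorized R n =
    \bigcup_(rho in [set rho | banach_function_norm rho /\
                               maximal_bounded_on rho]) bfs rho
  /\
  (forall f : Rn R n -> \bar R, measurable_fun setT f ->
    (exists w, A1_weight w /\
       {ae lebesgue_Rn, forall x, (`|f x| <= w x)%E}) <->
    (exists rho, [/\ banach_function_norm rho,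
       (rho (fun x => `|f x|) < +oo)%E & maximal_bounded_on rho])).
Proof.
have main (f : Rn R n -> \bar R) : measurable_fun setT f ->
    (exists w, A1_weight w /\
       {ae lebesgue_Rn, forall x, (`|f x| <= w x)%E}) <->
    (exists rho, [/\ banach_function_norm rho,
       (rho (fun x => `|f x|) < +oo)%E & maximal_bounded_on rho]).
  move=> mf; split=> [[w [A1w fw]]|[rho [nrho foo Mrho]]].
    exists (weighted_sup_norm w); split.
    - exact: weighted_banach_function_norm.
    - exact: weighted_sup_norm_lt_pinfty.
    - exact: maximal_bounded_on_weighted.
  exact: A1_majorant_of_bfs nrho Mrho mf foo.
split=> //; apply/seteqP; split=> f.
  by move=> [mf /(main f mf)[rho [nrho foo Mrho]]]; exists rho.
move=> [rho [nrho Mrho] [mf foo]]; split=> //; apply/(main f mf).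
by exists rho.
Qed.
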